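(* Let $\ell\ge 1$ and $n,m_1,\dots,m_\ell$ be positive integers, $m:=\sum_{i=1}^\ell m_i$. For $i=1,\dots,\ell$ let $C_i\subseteq\mathbb{R}^{m_i}$ be a nonempty closed convex set and $A_i\in\mathbb{R}^{m_i\times n}$ a nonzero matrix, and let $\bar v\in\mathbb{R}^n$. Assume $\bigcap_{i=1}^\ell A_i^{-1}\operatorname{ri}C_i\neq\emptyset$. Let $d(\mathbf y):=\frac12\|\sum_{i=1}^\ell A_i^Ty_i-\bar v\|^2-\frac12\|\bar v\|^2+\sum_{i=1}^\ell\sigma_{C_i}(y_i)$ for $\mathbf y=(y_1,\dots,y_\ell)\in\mathbb{R}^m$ and $d^*:=\inf d$. Let $\{\mathbf y^t\}$ be generated by the following algorithm: set $\gamma_i:=\lambda_{\max}(A_i^TA_i)$, $y_i^0:=0$, $x^0_\ell:=\bar v$; for $t=0,1,2,\dots$ set $x^{t+1}_0:=x^t_\ell$ and for $i=1,\dots,\ell$ compute $$x^{t+1}_i=(I-\gamma_i^{-1}A_i^TA_i)x^{t+1}_{i-1}+\gamma_i^{-1}A_i^T\operatorname{Proj}_{C_i}(\gamma_iy_i^t+A_ix^{t+1}_{i-1}),$$ $$y^{t+1}_i=y_i^t+\gamma_i^{-1}A_ix^{t+1}_{i-1}-\gamma_i^{-1}\operatorname{Proj}_{C_i}(\gamma_iy^t_i+A_ix^{t+1}_{i-1}),$$ then set $\mathbf y^{t+1}:=(y^{t+1}_1,\dots,y^{t+1}_\ell)$. Then $d(\mathbf y^t)\to d^*$ and $\operatorname{dist}(\mathbf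 y^t,\operatorname{Argmin} d)\to0$.
   Context: $A_i^{-1}S:=\{x: A_ix\in S\}$; $\operatorname{ri}$ denotes relative interior; $\sigma_C(y):=\sup_{u\in C}\langle y,u\rangle$ is the support function; $\operatorname{Proj}_C$ is the Euclidean projection onto $C$; $\lambda_{\max}$ is the largest eigenvalue; $\operatorname{Argmin} d$ is the set of minimizers of $d$. *)

(* Defs.v *)
From HB Require Import structures.
From mathcomp Require Import all_boot all_order all_algebra.
From mathcomp Require Import all_classical all_reals all_analysis.
Set Implicit Arguments. Unset Strict Implicit. Unset Printing Implicit Defensive.
Import Order.TTheory GRing.Theory Num.Theory.
Import numFieldNormedType.Exports.
Local Open Scope classical_set_scope.
Local Open Scope ring_scope.

Section Defs.
Variable R : realType.

Definition dotv (k : nat) (u v : 'cV[R]_k) : R := \sum_(j < k) u j 0 * v j 0.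
Definition enorm (k : nat) (u : 'cV[R]_k) : R := Num.sqrt (dotv u u).

Definition convex_setv (k : nat) (C : set 'cV[R]_k) : Prop :=
  forall x y, C x -> C y -> forall t : R, 0 <= t <= 1 ->
    C (t *: x + (1 - t) *: y).

Definition aff (k : nat) (C : set 'cV[R]_k) : set 'cV[R]_k :=
  [set x | exists (p : nat) (c : 'I_p -> 'cV[R]_k) (w : 'I_p -> R),
      (forall j, C (c j)) /\ \sum_(j < p) w j = 1 /\
      x = \sum_(j < p) w j *: c j].

Definition ri (k : nat) (C : set 'cV[R]_k) : set 'cV[R]_k :=
  [set x | C x /\ exists e : R, 0 < e /\
     forall z, aff C z -> enorm (z - x) < e -> C z].

Definition supp_fun (k : nat) (C : set 'cV[R]_k) (y : 'cV[R]_k) : \bar R :=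
  ereal_sup [set (dotv y u)%:E | u in C].

(* Euclidean projection onto C: a point of C nearest to z (unique when C is
   nonempty, closed and convex). *)
Definition proj (k : nat) (C : set 'cV[R]_k) (z : 'cV[R]_k) : 'cV[R]_k :=
  xget 0 [set p | C p /\ forall q, C q -> enorm (z - p) <= enorm (z - q)].

Definition is_lambda_max (k : nat) (M : 'M[R]_k) (r : R) : Prop :=
  eigenvalue M r /\ forall s, eigenvalue M s -> s <= r.

Section Blocks.
Local Unset Implicit Arguments.
Variables (l n : nat) (m : 'I_l -> nat).
Definition blockv := forall i : 'I_l, 'cV[R]_(m i).

Definition bsub (y z : blockv) : blockv := fun i => y i - z i.
Definition bnorm (y : blockv) : R := Num.sqrt (\sum_(i < l) dotv (y i) (y i)).

Variables (C : forall i : 'I_l, set 'cV[R]_(m i))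
          (A : forall i : 'I_l, 'M[R]_(m i, n)) (vbar : 'cV[R]_n).

Definition dual_obj (y : blockv) : \bar R :=
  ((2^-1) * dotv (\sum_(i < l) ((@A i)^T *m (y i : 'cV[R]_(m i))) - vbar)
                 (\sum_(i < l) ((@A i)^T *m (y i : 'cV[R]_(m i))) - vbar)
   - (2^-1) * dotv vbar vbar)%:E
  + (\sum_(i < l) supp_fun (@C i) (y i : 'cV[R]_(m i)))%E.

Definition dual_inf : \bar R := ereal_inf [set dual_obj y | y in [set: blockv]].

Definition Argmin_dual : set blockv :=
  [set y | forall z, (dual_obj y <= dual_obj z)%E].

Definition bdist (y : blockv) (S : set blockv) : \bar R :=
  ereal_inf [set (bnorm (bsub y z))%:E | z in S].

Variable gamma : 'I_l -> R.

Definition xstep (i : 'I_l) (x : 'cV[R]_n) (yi : 'cV[R]_(m i)) : 'cV[R]_n :=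
  (1%:M - (gamma i)^-1 *: ((@A i)^T *m @A i)) *m x
  + (gamma i)^-1 *: ((@A i)^T *m proj (@C i) (gamma i *: yi + @A i *m x)).

Definition ystep (i : 'I_l) (x : 'cV[R]_n) (yi : 'cV[R]_(m i)) : 'cV[R]_(m i) :=
  yi + (gamma i)^-1 *: (@A i *m x)
  - (gamma i)^-1 *: proj (@C i) (gamma i *: yi + @A i *m x).

(* inner_x k x0 Y = x^{t+1}_k, given x^{t+1}_0 = x0 and Y = y^t
   (blocks are 0-indexed here: block k is the paper's block k+1). *)
Fixpoint inner_x (k : nat) (x0 : 'cV[R]_n) (Y : blockv) : 'cV[R]_n :=
  match k with
  | 0 => x0
  | k'.+1 =>
      let x := inner_x k' x0 Y in
      match (insub k' : option 'I_l) with
      | Some i => xstep i x (Y i)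
      | None => x
      end
  end.

Fixpoint alg (t : nat) : 'cV[R]_n * blockv :=
  match t with
  | 0 => (vbar, fun i => 0)
  | t'.+1 =>
      let X := (alg t').1 in
      let Y := (alg t').2 in
      (inner_x l X Y, fun i : 'I_l => ystep i (inner_x i X Y) (Y i))
  end.

End Blocks.
End Defs.

Arguments dual_obj {R l n m}.
Arguments dual_inf {R l n m}.
Arguments Argmin_dual {R l n m}.
Arguments bdist {R l m}.
Arguments alg {R l n m}.
Arguments inner_x {R l n m}.
Arguments xstep {R l n m}.
Arguments ystep {R l n m}.

(* Main.v *)
(* In the block vector Y = (y_1, ..., y_l), with A stacking the A_i and C the product of
   the C_i, the dual objective is d(Y) = sup_{u in C} (q(Y) + <Y, u>), q quadratic.
   Each inner step is a proximal gradient step on one block, so with p_i the projection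
   computed for block i, y_i is normal to C_i at p_i, x = vbar - A^T Y, and
   g = p - A x is a subgradient of d at Y.  One sweep lowers d by at least
   (1/2) sum_i gamma_i |y_i^{t+1} - y_i^t|^2; d is bounded below, so g -> 0.

   If A xh is in ri C, every recession direction of d is a lineality direction: it lies
   in L = {Y | A^T Y = 0, <Y, u - A xh> = 0 on C}, along which d is constant.  Hence the
   iterates are bounded modulo L, and g is orthogonal to L, so
   d(Y^t) <= d(Z) - <g, Z - Y^t> yields d(Y^t) -> inf d, and every cluster point of the
   iterates reduced modulo L is a minimizer. *)

Require Import Defs.
From HB Require Import structures.
From mathcomp Require Import all_boot all_order all_algebra.
From mathcomp Require Import all_classical all_reals all_analysis.
From mathcomp Require Import ring lra.
Set Implicit Arguments. Unset Strict Implicit. Unset Printing Implicit Defensive.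
Import Order.TTheory GRing.Theory Num.Theory.
Import numFieldNormedType.Exports.
Local Open Scope classical_set_scope.
Local Open Scope ring_scope.

(** * Euclidean geometry and compactness *)

Section Dot.
Variable R : realType.
Implicit Types k n : nat.

Lemma dotvE k (u v : 'cV[R]_k) : dotv u v = (u^T *m v) 0 0.
Proof. by rewrite mxE; apply: eq_bigr => j _; rewrite mxE. Qed.

Lemma dotvC k (u v : 'cV[R]_k) : dotv u v = dotv v u.
Proof. by apply: eq_bigr => j _; rewrite mulrC. Qed.

Lemma dotvDl k (u v w : 'cV[R]_k) : dotv (u + v) w = dotv u w + dotv v w.
Proof. by rewrite -big_split; apply: eq_bigr => j _; rewrite mxE mulrDl. Qed.

Lemma dotvZl k a (u v : 'cV[R]_k) : dotv (a *: u) v = a * dotv u v.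
Proof. by rewrite mulr_sumr; apply: eq_bigr => j _; rewrite mxE mulrA. Qed.

Lemma dotvNl k (u v : 'cV[R]_k) : dotv (- u) v = - dotv u v.
Proof. by rewrite -scaleN1r dotvZl mulN1r. Qed.

Lemma dotvBl k (u v w : 'cV[R]_k) : dotv (u - v) w = dotv u w - dotv v w.
Proof. by rewrite dotvDl dotvNl. Qed.

Lemma dotvDr k (u v w : 'cV[R]_k) : dotv w (u + v) = dotv w u + dotv w v.
Proof. by rewrite ![dotv w _]dotvC dotvDl. Qed.

Lemma dotvZr k a (u v : 'cV[R]_k) : dotv v (a *: u) = a * dotv v u.
Proof. by rewrite ![dotv v _]dotvC dotvZl. Qed.

Lemma dotvNr k (u v : 'cV[R]_k) : dotv v (- u) = - dotv v u.
Proof. by rewrite ![dotv v _]dotvC dotvNl. Qed.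

Lemma dotvBr k (u v w : 'cV[R]_k) : dotv w (u - v) = dotv w u - dotv w v.
Proof. by rewrite dotvDr dotvNr. Qed.

Lemma dot0v k (u : 'cV[R]_k) : dotv 0 u = 0.
Proof. by rewrite -(scale0r 0) dotvZl mul0r. Qed.

Lemma dotv0 k (u : 'cV[R]_k) : dotv u 0 = 0.
Proof. by rewrite dotvC dot0v. Qed.

Definition dotvW := (dotvDl, dotvDr, dotvNl, dotvNr, dotvZl, dotvZr, dot0v, dotv0).

Lemma dotv_trmx k n (A : 'M[R]_(k, n)) y x : dotv (A^T *m y) x = dotv y (A *m x).
Proof. by rewrite !dotvE trmx_mul trmxK mulmxA. Qed.

Lemma dotv_ge0 k (u : 'cV[R]_k) : 0 <= dotv u u.
Proof. by apply: sumr_ge0 => j _; rewrite -expr2 sqr_ge0. Qed.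

Lemma dotv_eq0 k (u : 'cV[R]_k) : dotv u u = 0 -> u = 0.
Proof.
move=> /eqP; rewrite psumr_eq0; last by move=> j _; rewrite -expr2 sqr_ge0.
move=> /allP u0; apply/matrixP => i j; rewrite (ord1 j) mxE.
have := u0 i (mem_index_enum _).
by rewrite -expr2 sqrf_eq0 => /eqP.
Qed.

(** For [c > 0] evaluate at the minimizer [- (b / c)]. For [c <= 0] a suitable [s] makes the
    expression negative unless [b = c = 0]; this degenerate case lets the lemma serve semidefinite
    forms. *)
Lemma quadratic_nonneg_discr (a b c : R) : 0 <= a ->
  (forall s, 0 <= a + 2 * s * b + s ^+ 2 * c) -> b ^+ 2 <= a * c.
Proof.
move=> a0 H; case: (ltrP 0 c) => [c0|c0].
  have := H (- (b / c)); set q := b / c.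
  have -> : b = q * c by rewrite /q divfK // gt_eqF.
  move=> h; nra.
case: (eqVneq b 0) => [b0|b0].
  have c1 : 0 <= c.
    rewrite leNgt; apply/negP => cn.
    have cm : 0 < - c by lra.
    have := H (1 + a / (- c)); rewrite b0.
    have e : a / - c * - c = a by rewrite divfK // gt_eqF.
    have : 0 <= a / - c by rewrite divr_ge0 // ltW.
    move: e; set q := a / - c => e q0.
    have : c * (1 + q + q ^+ 2) < 0 by rewrite nmulr_rlt0 //; nra.
    by rewrite -e !mulr0 expr2; nra.
  by rewrite b0 expr0n /= mulr_ge0.
have := H (- ((a + 1) / (2 * b))).
have e : (a + 1) / (2 * b) * (2 * b) = a + 1.
  by rewrite divfK // mulf_neq0 // pnatr_eq0.
set q := (a + 1) / (2 * b) in e *; move=> h; nra.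
Qed.

Lemma dotv_CS k (u v : 'cV[R]_k) : dotv u v ^+ 2 <= dotv u u * dotv v v.
Proof.
apply: quadratic_nonneg_discr => [|s]; first exact: dotv_ge0.
have := dotv_ge0 (u + s *: v); rewrite !dotvW (dotvC v u).
by move=> h; rewrite expr2; lra.
Qed.

(** Cauchy-Schwarz; the [+ 1] keeps the denominator positive when [v = 0]. *)
Lemma dotv_le_eps k (u v : 'cV[R]_k) (e : R) : 0 < e ->
  dotv u u <= e ^+ 2 / (dotv v v + 1) -> dotv u v <= e.
Proof.
move=> e0; have v0 := dotv_ge0 v; rewrite ler_pdivlMr; last lra.
move=> h; rewrite -[e]gtr0_norm //; apply: (le_trans (ler_norm _)).
rewrite -ler_sqr ?nnegrE // !(real_normK (num_real _)).
have := dotv_CS u v; have u0 := dotv_ge0 u; lra.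
Qed.

Lemma dotvDD k (u v : 'cV[R]_k) :
  dotv (u + v) (u + v) <= 2 * dotv u u + 2 * dotv v v.
Proof.
have := dotv_ge0 (u - v); rewrite !dotvW (dotvC v u) => h; lra.
Qed.

Lemma enorm_le k (u v : 'cV[R]_k) : (enorm u <= enorm v) = (dotv u u <= dotv v v).
Proof. by rewrite /enorm ler_sqrt // dotv_ge0. Qed.

(** Sequential cluster points in squared distance: limits are taken through inequalities, without
    extracting subsequences. *)
Definition clusters_at k (z : nat -> 'cV[R]_k) (zb : 'cV[R]_k) :=
  forall e : R, 0 < e -> forall N, exists t, (N <= t)%N /\
    dotv (z t - zb) (z t - zb) < e.

(** Bolzano-Weierstrass, from compactness of a box of row vectors; hence the transposes. *)
Lemma bounded_clusters k (z : nat -> 'cV[R]_k) (M : R) :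
  (forall t, dotv (z t) (z t) <= M) -> exists zb, clusters_at z zb.
Proof.
move=> zM.
have zc t j : z t j 0 \in `[- (M + 1), M + 1].
  have h : z t j 0 ^+ 2 <= M.
    apply: le_trans (zM t); rewrite /dotv (bigD1 j) //= expr2 lerDl.
    by apply: sumr_ge0 => i _; rewrite -expr2 sqr_ge0.
  by rewrite in_itv /=; apply/andP; split; nra.
have := @rV_compact R k (fun=> `[- (M + 1), M + 1]%classic)
          (fun=> @segment_compact _ _ _).
move=> /(_ ((fun t => (z t)^T) @ \oo)) [].
  by exists 0%N => // t _ j /=; rewrite mxE; exact: zc.
move=> a [_ ca]; exists a^T => e e0 N.
(* A sup-norm radius: [d <= 1] gives [d ^+ 2 <= d], and [k] squared coordinates then add up to at
   most [k * d < e]. *)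
pose d := Num.min 1 (e / (k%:R + 1)).
have k1 : 0 < k%:R + 1 :> R by rewrite ltr_wpDl.
have d0 : 0 < d by rewrite lt_min ltr01 divr_gt0.
have [] := ca [set x | exists t, (N <= t)%N /\ x = (z t)^T] (ball a d).
- by exists N => // t /= Nt; exists t.
- exact: nbhsx_ballx.
move=> x [[t [Nt ->]] /= bt]; exists t; split => //.
have h j : (z t - a^T) j 0 * (z t - a^T) j 0 <= d.
  have := bt.2 0 j; rewrite !mxE /ball /= distrC => /ltW h.
  have d1 : d <= 1 by rewrite ge_min lexx.
  rewrite -expr2 -(real_normK (num_real _)); have := normr_ge0 ((z t) j 0 - a 0 j); set w := `|_|.
  rewrite -/w in h; move=> w0; nra.
apply: (@le_lt_trans _ _ (\sum_(j < k) d)); first exact: ler_sum.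
rewrite sumr_const card_ord -mulr_natr.
apply: (@lt_le_trans _ _ (d * (k%:R + 1))); first by rewrite ltr_pM2l // ltrDl.
by rewrite -ler_pdivlMr // ge_min lexx orbT.
Qed.

Lemma clusters_le k (z : nat -> 'cV[R]_k) zb w (b : R) : clusters_at z zb ->
  (forall e, 0 < e -> exists N, forall t, (N <= t)%N -> dotv (z t) w <= b + e) ->
  dotv zb w <= b.
Proof.
move=> zzb H; apply/ler_addgt0Pr => e e0.
have e2 : 0 < e / 2 by rewrite divr_gt0.
have [N HN] := H _ e2.
have w0 : 0 < dotv (- w) (- w) + 1 by rewrite ltr_wpDl // dotv_ge0.
have [t [Nt ht]] := zzb _ (divr_gt0 (exprn_gt0 2 e2) w0) N.
have := dotv_le_eps e2 (ltW ht); rewrite dotvNr dotvBl.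
have := HN _ Nt; lra.
Qed.

(** The hypothesis is squared to match the bounds that Cauchy-Schwarz provides. *)
Lemma clusters_eq k (z : nat -> 'cV[R]_k) zb w (b : R) : clusters_at z zb ->
  (forall e, 0 < e -> exists N, forall t, (N <= t)%N ->
     (dotv (z t) w - b) ^+ 2 <= e) ->
  dotv zb w = b.
Proof.
move=> zzb H.
have H2 e : 0 < e -> exists N, forall t, (N <= t)%N -> `|dotv (z t) w - b| <= e.
  move=> e0; have [N HN] := H _ (exprn_gt0 2 e0); exists N => t /HN.
  by rewrite -(real_normK (num_real _)) ler_sqr ?nnegrE // ltW.
apply/eqP; rewrite eq_le; apply/andP; split.
  apply: (clusters_le zzb) => e /H2[N HN]; exists N => t /HN.
  by rewrite ler_norml; lra.
rewrite -lerN2 -dotvNr; apply: (clusters_le zzb) => e /H2[N HN]; exists N => t /HN.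
by rewrite ler_norml dotvNr; lra.
Qed.

Lemma invS_le (e : R) : 0 < e -> exists N, forall t, (N <= t)%N -> t.+1%:R^-1 <= e.
Proof.
move=> e0; have [N _ HN] := near_infty_natSinv_lt (PosNum e0).
by exists N => t /HN /ltW.
Qed.

Lemma clusters_closed k (C : set 'cV[R]_k) (z : nat -> 'cV[R]_k) zb : closed C ->
  clusters_at z zb -> (forall t, C (z t)) -> C zb.
Proof.
move=> Ccl zzb Cz; apply: Ccl => B /nbhs_ballP[d /= d0 dB].
have [t [_ ht]] := zzb _ (exprn_gt0 2 d0) 0%N.
exists (z t); split => //; apply: dB; split => // i j; rewrite (ord1 j).
  rewrite /ball /= distrC -ltr_sqr ?nnegrE ?normr_ge0 ?(ltW d0) //.
  rewrite (real_normK (num_real _)).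
apply: le_lt_trans ht; rewrite /dotv (bigD1 i) //= !mxE expr2 lerDl.
by apply: sumr_ge0 => ? _; rewrite -expr2 sqr_ge0.
Qed.

(** A minimizing sequence is bounded and clusters at a nearest point. Closedness is asked
    sequentially so that [lineality] fits too. *)
Lemma nearest_point k (C : set 'cV[R]_k) (z : 'cV[R]_k) :
  (forall zs zb, clusters_at zs zb -> (forall t, C (zs t)) -> C zb) ->
  C !=set0 ->
  exists p, C p /\ forall q, C q -> dotv (z - p) (z - p) <= dotv (z - q) (z - q).
Proof.
move=> Ccl [c0 Cc0].
pose S := [set dotv (z - q) (z - q) | q in C].
have hS : has_inf S.
  split; first by exists (dotv (z - c0) (z - c0)), c0.
  by exists 0 => _ [q _ <-]; exact: dotv_ge0.
have /choice[q qP] : forall t : nat, exists q, C q /\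
    dotv (z - q) (z - q) <= inf S + t.+1%:R^-1.
  move=> t.
  have t0 : 0 < t.+1%:R^-1 :> R by rewrite invr_gt0.
  have [_ [q Cq <-] h] := inf_adherent t0 hS.
  by exists q; split => //; exact: ltW.
have [p qp] : exists p, clusters_at q p.
  apply: (@bounded_clusters _ _ (2 * dotv z z + 2 * (inf S + 1))) => t.
  have := dotvDD z (- (z - q t)); rewrite subKr dotvNl dotvNr opprK => h.
  have := (qP t).2.
  have : t.+1%:R^-1 <= 1 :> R by rewrite invf_le1 // ler1n.
  move: (t.+1%:R^-1) (inf S) (dotv (z - q t) _) (dotv z z) (dotv (q t) (q t)) h.
  by move=> r i a b c *; lra.
exists p; split; first by apply: (Ccl _ _ qp) => t; case: (qP t).
move=> c Cc; apply: (@le_trans _ _ (inf S)); last first.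
  by apply: ge_inf; [exact: hS.2 | exists c].
(* Since |z - q|^2 >= |z - p|^2 - 2 <z - p, q - p>, the claim reduces to a linear functional of
   [q t], which [clusters_le] handles. *)
rewrite -subr_ge0 -(@lerD2l _ (dotv p (- 2 *: (z - p)))) addr0.
apply: (clusters_le qp) => e /invS_le[N HN]; exists N => t /HN te.
have [_] := qP t; have := dotv_ge0 (q t - p).
have -> : z - q t = (z - p) - (q t - p) by rewrite opprB addrA subrK.
move: (z - p) => w.
rewrite !dotvW [dotv w p]dotvC [dotv w (q t)]dotvC [dotv p (q t)]dotvC.
move: (t.+1%:R^-1) te => r te; lra.
Qed.

Lemma nearest_point_variational k (C : set 'cV[R]_k) (z p : 'cV[R]_k) : convex_setv C -> C p ->
  (forall q, C q -> dotv (z - p) (z - p) <= dotv (z - q) (z - q)) ->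
  forall q, C q -> dotv (z - p) (q - p) <= 0.
Proof.
move=> Ccv Cp H q Cq; rewrite leNgt; apply/negP => h.
set a := dotv (z - p) (q - p) in h; have b0 := dotv_ge0 (q - p).
set b := dotv (q - p) (q - p) in b0.
(* Moving from [p] towards [q] by [s] changes the squared distance by [s * (s * b - 2 * a)],
   negative for this [s]. *)
pose s := Num.min 1 (a / (b + 1)).
have b1 : 0 < b + 1 by lra.
have s0 : 0 < s by rewrite lt_min ltr01 divr_gt0.
have s1 : s <= 1 by rewrite ge_min lexx.
have sa : s * (b + 1) <= a by rewrite -ler_pdivlMr // ge_min lexx orbT.
have s01 : 0 <= s <= 1 by rewrite ltW.
have := H _ (Ccv q p Cq Cp s s01).
have -> : z - (s *: q + (1 - s) *: p) = (z - p) - s *: (q - p).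
  by apply/matrixP => i j; rewrite !mxE; ring.
have -> w v : dotv (w - s *: v) (w - s *: v) =
    dotv w w - 2 * s * dotv w v + s ^+ 2 * dotv v v.
  by rewrite !dotvW (dotvC v w); ring.
rewrite -/a -/b => h2; have : s * (2 * a) <= s * (s * b) by lra.
rewrite ler_pM2l //; nra.
Qed.

(** The value chosen by [xget] is a genuine nearest point because one exists. *)
Lemma proj_variational k (C : set 'cV[R]_k) (z : 'cV[R]_k) : closed C -> convex_setv C ->
  C !=set0 ->
  C (Defs.proj C z) /\ forall q, C q -> dotv (z - Defs.proj C z) (q - Defs.proj C z) <= 0.
Proof.
move=> Ccl Ccv C0.
have : [set p | C p /\ forall q, C q -> enorm (z - p) <= enorm (z - q)] (Defs.proj C z).
  apply: xgetPex; have [zs zb|//|p [Cp Hp]] := @nearest_point _ C z.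
    exact: clusters_closed.
  by exists p; split => // q Cq; rewrite enorm_le; exact: Hp.
move=> [Cp Hp]; split => //; apply: nearest_point_variational => // q Cq.
by rewrite -enorm_le; exact: Hp.
Qed.

(** [K] is the squared Frobenius norm: apply Cauchy-Schwarz to each row. *)
Lemma mulmx_dotv_bound k n (A : 'M[R]_(k, n)) :
  exists2 K, 0 <= K & forall x, dotv (A *m x) (A *m x) <= K * dotv x x.
Proof.
pose r i : 'cV[R]_n := (row i A)^T.
exists (\sum_i dotv (r i) (r i)); first by apply: sumr_ge0 => i _; exact: dotv_ge0.
move=> x; rewrite /dotv mulr_suml; apply: ler_sum => i _.
have := dotv_CS (r i) x.
suff -> : dotv (r i) x = (A *m x) i 0 by rewrite expr2.
by rewrite mxE; apply: eq_bigr => j _; rewrite !mxE.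
Qed.

(* The supremum [s] of the Rayleigh quotient is an eigenvalue: along a maximizing
   sequence [x], Cauchy-Schwarz for the form [s |.|^2 - |A .|^2] gives
   [(s - A^T A) x t -> 0]. *)
Lemma rayleigh_sup_eigenvalue k n (A : 'M[R]_(k, n)) : (0 < n)%N ->
  exists s, eigenvalue (A^T *m A) s /\
    forall x, dotv (A *m x) (A *m x) <= s * dotv x x.
Proof.
case: n A => // n A _.
pose S := [set dotv (A *m x) (A *m x) | x in [set x | dotv x x = 1]].
have [K K0 HK] := mulmx_dotv_bound A.
have hS : has_sup S.
  split; last by exists K => _ [x /= x1 <-]; have := HK x; rewrite x1 mulr1.
  exists (dotv (A *m delta_mx 0 0) (A *m delta_mx 0 0)), (delta_mx 0 0) => //=.
  rewrite /dotv (bigD1 0) //= big1 ?addr0 => [|j j0].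
    by rewrite mxE !eqxx mulr1.
  by rewrite mxE (negbTE j0) /= mul0r.
set s := sup S.
have sP x : dotv (A *m x) (A *m x) <= s * dotv x x.
  case: (eqVneq (dotv x x) 0) => [/dotv_eq0 ->|x0].
    by rewrite mulmx0 !dot0v mulr0.
  have xp : 0 < dotv x x by rewrite lt_neqAle eq_sym x0 dotv_ge0.
  have r0 : 0 < Num.sqrt (dotv x x) by rewrite sqrtr_gt0.
  have rr : Num.sqrt (dotv x x) ^+ 2 = dotv x x by rewrite sqr_sqrtr // dotv_ge0.
  set r := Num.sqrt _ in r0 rr.
  rewrite -ler_pdivrMr // -rr.
  apply: ub_le_sup; first exact: hS.2.
  exists (r^-1 *: x) => /=; first by rewrite dotvZl dotvZr -rr; field; rewrite gt_eqF.
  by rewrite -scalemxAr dotvZl dotvZr; field; rewrite gt_eqF.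
pose B u v := s * dotv u v - dotv (A *m u) (A *m v).
have Bpos u : 0 <= B u u by rewrite subr_ge0.
have BCS u v : B u v ^+ 2 <= B u u * B v v.
  apply: quadratic_nonneg_discr => // r.
  have := Bpos (u + r *: v); rewrite /B mulmxDr -scalemxAr !dotvW.
  by rewrite (dotvC v u) (dotvC (A *m v)) => h; rewrite expr2; lra.
have /choice[x xP] : forall t : nat, exists x, dotv x x = 1 /\ B x x <= t.+1%:R^-1.
  move=> t.
  have t0 : 0 < t.+1%:R^-1 :> R by rewrite invr_gt0.
  have [_ [x /= x1 <-] h] := sup_adherent t0 hS.
  exists x; split => //; rewrite /B x1 mulr1; rewrite -/s in h. move: (t.+1%:R^-1) h => r h; lra.
have [xb xxb] : exists xb, clusters_at x xb.
  by apply: (@bounded_clusters _ _ 1) => t; rewrite (xP t).1.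
(* [eigenvalue] is about row vectors, hence [xb^T]; [xb] is nonzero as a cluster point of unit
   vectors. *)
exists s; split => //; apply/eigenvalueP; exists xb^T; last first.
  apply/eqP => /(congr1 trmx); rewrite trmxK trmx0 => xb0.
  have [t [_]] := xxb _ ltr01 0%N.
  by rewrite xb0 subr0 (xP t).1 ltxx.
suff e : A^T *m A *m xb = s *: xb.
  have -> : s *: xb^T = (s *: xb)^T by rewrite linearZ.
  by rewrite -e !trmx_mul trmxK.
apply/eqP; rewrite -subr_eq0 -oppr_eq0 opprB; apply/eqP/dotv_eq0.
set w := _ - _.
have Bw u v : B u v = dotv u (s *: v - A^T *m A *m v).
  by rewrite /B dotvBr dotvZr -mulmxA [dotv u (A^T *m _)]dotvC dotv_trmx
    [dotv (A *m v) _]dotvC.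
(* By symmetry of [B], |w|^2 is [B xb w], a cluster value of [B (x t) w], whose square is at most
   [B (x t) (x t) * B w w]. *)
have -> : dotv w w = B xb w by rewrite -Bw /B dotvC (dotvC (A *m w)).
rewrite Bw; apply: (clusters_eq xxb) => e e0.
have w1 : 0 < B w w + 1 by rewrite ltr_wpDl.
have [N HN] := invS_le (divr_gt0 e0 w1); exists N => t /HN te.
rewrite subr0 -Bw; apply: (le_trans (BCS _ _)).
apply: (@le_trans _ _ (e / (B w w + 1) * (B w w + 1))); last first.
  by rewrite divfK // gt_eqF.
by apply: ler_pM => //; [exact: le_trans (xP t).2 te | rewrite lerDl].
Qed.

(** The Rayleigh bound [s] is itself an eigenvalue, hence at most [g]. *)
Lemma lambda_max_rayleigh k n (A : 'M[R]_(k, n)) g : (0 < n)%N ->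
  is_lambda_max (A^T *m A) g ->
  forall x, dotv (A *m x) (A *m x) <= g * dotv x x.
Proof.
move=> n0 [_ Hg] x; have [s [/Hg sg Hs]] := rayleigh_sup_eigenvalue A n0.
by apply: (le_trans (Hs x)); rewrite ler_wpM2r // dotv_ge0.
Qed.

Lemma lambda_max_gt0 k n (A : 'M[R]_(k, n)) g : (0 < n)%N -> A != 0 ->
  is_lambda_max (A^T *m A) g -> 0 < g.
Proof.
move=> n0 A0 /(lambda_max_rayleigh n0) H; rewrite ltNge; apply/negP => g0.
move/eqP: A0; apply; apply/matrixP => i j; rewrite [RHS]mxE.
have : A *m (delta_mx j 0 : 'cV_n) = 0.
  apply: dotv_eq0; apply/eqP; rewrite eq_le dotv_ge0 andbT.
  by apply: (le_trans (H _)); rewrite mulr_le0_ge0 // dotv_ge0.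
by rewrite -colE => /matrixP/(_ i 0); rewrite !mxE.
Qed.

(** With a = |A^T y|^2, Cauchy-Schwarz gives a^2 = <y, A A^T y>^2 <= |y|^2 g a; cancel a. *)
Lemma rayleigh_trmx k n (A : 'M[R]_(k, n)) g : 0 < g ->
  (forall x, dotv (A *m x) (A *m x) <= g * dotv x x) ->
  forall y, dotv (A^T *m y) (A^T *m y) <= g * dotv y y.
Proof.
move=> g0 H y; set a := dotv _ _.
have := dotv_CS y (A *m (A^T *m y)); rewrite -dotv_trmx -/a.
have := H (A^T *m y); rewrite -/a => h1 h2.
have a0 : 0 <= a := dotv_ge0 _; have y0 := dotv_ge0 y.
case: (eqVneq a 0) => [->|an0]; first by rewrite mulr_ge0 // ltW.
have ap : 0 < a by rewrite lt_neqAle eq_sym an0.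
rewrite -(ler_pM2l ap) -expr2; apply: (le_trans h2).
by apply: (@le_trans _ _ (dotv y y * (g * a))); [rewrite ler_wpM2l|lra].
Qed.

End Dot.

(** * The dual objective modulo its lineality space *)

Section Dual.
Variables (R : realType) (N n : nat) (C : set 'cV[R]_N) (A : 'M[R]_(N, n)).
Variables (v xh : 'cV[R]_n).
Let ph := A *m xh.

Definition dual_quad (Y : 'cV[R]_N) : R :=
  2^-1 * dotv (A^T *m Y - v) (A^T *m Y - v) - 2^-1 * dotv v v.

Definition dual_minorant (Y u : 'cV[R]_N) : R := dual_quad Y + dotv Y u.

(* [dual_le Y M] states [d Y <= M] without extended reals. *)
Definition dual_le (Y : 'cV[R]_N) (M : R) := forall u, C u -> dual_minorant Y u <= M.

Definition lineality : set 'cV[R]_N :=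
  [set Y | A^T *m Y = 0 /\ forall u, C u -> dotv Y (u - ph) = 0].

Lemma dual_quad_gradient (Y Z : 'cV[R]_N) :
  dual_quad Y + dotv (A *m (A^T *m Y - v)) (Z - Y) <= dual_quad Z.
Proof.
rewrite /dual_quad [dotv (A *m _) _]dotvC -dotv_trmx.
have -> : A^T *m Z - v = (A^T *m Y - v) + A^T *m (Z - Y).
  by rewrite mulmxBr; apply/matrixP => i j; rewrite !mxE; ring.
have := dotv_ge0 (A^T *m (Z - Y)).
move: (A^T *m (Z - Y)) (A^T *m Y - v) => d w; rewrite !dotvW (dotvC w d); lra.
Qed.

(** From [A^T *m l = 0] follows <l, ph> = <A^T l, xh> = 0, so <l, u> = <l, u - ph> = 0. *)
Lemma dual_minorant_lineality Y l u : lineality l -> C u ->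
  dual_minorant (Y + l) u = dual_minorant Y u.
Proof.
move=> [Al lu] Cu; rewrite /dual_minorant /dual_quad mulmxDr Al addr0 dotvDl.
have := lu u Cu; rewrite dotvBr -dotv_trmx Al dot0v subr0 => ->.
by rewrite addr0.
Qed.

(** Orthogonal projection onto the subspace [lineality]: the variational inequality, applied to both
    [l] and [- l], gives orthogonality. *)
Lemma lineality_decomposition Y :
  exists Y', lineality (Y - Y') /\ forall l, lineality l -> dotv Y' l = 0.
Proof.
have L0 : lineality 0 by split=> [|u _]; rewrite ?mulmx0 ?dot0v.
have [||p [Lp Hp]] := @nearest_point R N lineality Y.
- move=> zs zb zszb Lz; split=> [|u Cu].
    apply: dotv_eq0; rewrite dotv_trmx.
    apply: (clusters_eq zszb) => e e0; exists 0%N => t _.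
    by rewrite -dotv_trmx (Lz t).1 dot0v subr0 expr0n ltW.
  apply: (clusters_eq zszb) => e e0; exists 0%N => t _.
  by rewrite (Lz t).2 // subr0 expr0n ltW.
- by exists 0.
have Lcv : convex_setv lineality.
  move=> a b [Aa Ha] [Ab Hb] t _; split=> [|u Cu].
    by rewrite mulmxDr -!scalemxAr Aa Ab !scaler0 addr0.
  by rewrite dotvDl !dotvZl Ha // Hb // !mulr0 addr0.
have var := nearest_point_variational Lcv Lp Hp.
exists (Y - p); rewrite subKr; split=> // l [Al lu].
have le0 l' : lineality l' -> dotv (Y - p) l' <= 0.
  move=> [Al' lu']; rewrite -[l'](addrK p); apply: var.
  split=> [|u Cu]; first by rewrite mulmxDr Lp.1 Al' addr0.
  by rewrite dotvDl lu' // Lp.2 // addr0.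
apply/eqP; rewrite eq_le le0 //= -oppr_le0 -dotvNr le0 //; split=> [|u Cu].
  by rewrite mulmxN Al oppr0.
by rewrite dotvNl lu ?oppr0.
Qed.

Hypothesis C_ph : C ph.
(* This is what [A xh \in ri C] is used for: a linear functional maximal over [C] at
   [A xh] is constant on [C]. *)
Hypothesis C_ri : forall Y, (forall u, C u -> dotv Y (u - ph) <= 0) ->
  forall u, C u -> dotv Y (u - ph) = 0.

(** Otherwise normalized counterexamples cluster at a point both in [lineality] and orthogonal to
    it, hence at 0, although they have norm 1. *)
Lemma coercive_mod_lineality (a b : R) : exists c, forall Y,
  (forall l, lineality l -> dotv Y l = 0) ->
  dotv (A^T *m Y) (A^T *m Y) <= a -> (forall u, C u -> dotv Y (u - ph) <= b) ->
  dotv Y Y <= c.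
Proof.
apply: contrapT => /forallNP H.
have /choice[Z ZP] : forall t : nat, exists Z, [/\ dotv Z Z = 1,
    forall l, lineality l -> dotv Z l = 0,
    dotv (A^T *m Z) (A^T *m Z) <= `|a| * t.+1%:R^-1 &
    forall u, C u -> dotv Z (u - ph) <= `|b| * t.+1%:R^-1].
  (* The bound [t.+1%:R ^+ 2] forces |Y| > t + 1, so normalizing shrinks [a] and [b] by at least 1 /
     (t + 1). *)
  move=> t; have /existsNP[Y /not_implyP[YL /not_implyP[Ya /not_implyP[Yb /negP]]]]
    := H (t.+1%:R ^+ 2).
  rewrite -ltNge => Yt.
  have r0 : 0 < Num.sqrt (dotv Y Y).
    by rewrite sqrtr_gt0 (lt_trans _ Yt) // exprn_gt0.
  have rr : Num.sqrt (dotv Y Y) ^+ 2 = dotv Y Y by rewrite sqr_sqrtr // dotv_ge0.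
  set r := Num.sqrt _ in r0 rr.
  have tr : t.+1%:R <= r.
    by rewrite -ler_sqr ?nnegrE ?(ltW r0) // rr ltW.
  have ri : r^-1 <= t.+1%:R^-1 by rewrite lef_pV2 ?posrE.
  have ri0 : 0 < r^-1 by rewrite invr_gt0.
  have ri1 : r^-1 <= 1.
    by rewrite invf_le1 //; apply: le_trans tr; rewrite ler1n.
  exists (r^-1 *: Y); split.
  - by rewrite dotvZl dotvZr -rr; field; rewrite gt_eqF.
  - by move=> l Ll; rewrite dotvZl YL // mulr0.
  - rewrite -scalemxAr dotvZl dotvZr.
    have := ler_norm a; have := dotv_ge0 (A^T *m Y).
    move: (t.+1%:R^-1) ri (dotv (A^T *m Y) _) Ya => s rs d da d0 aa.
    have : r^-1 * d <= 1 * d by rewrite ler_wpM2r.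
    move=> h; have : r^-1 * (r^-1 * d) <= r^-1 * `|a| by rewrite ler_wpM2l; lra.
    move=> h2; have : r^-1 * `|a| <= s * `|a| by rewrite ler_wpM2r.
    lra.
  - move=> u Cu; rewrite dotvZl.
    have h : r^-1 * dotv Y (u - ph) <= r^-1 * `|b|.
      by rewrite ler_wpM2l ?(ltW ri0) // (le_trans (Yb u Cu)) // ler_norm.
    by apply: (le_trans h); rewrite [leRHS]mulrC ler_wpM2r.
have [Zb ZZb] : exists Zb, clusters_at Z Zb.
  by apply: (@bounded_clusters _ _ _ 1) => t; case: (ZP t) => ->.
have lim0 (c e : R) : 0 < e -> exists N, forall t, (N <= t)%N -> `|c| * t.+1%:R^-1 <= e.
  move=> e0; have c1 : 0 < `|c| + 1 by rewrite ltr_wpDl.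
  have [K HK] := invS_le (divr_gt0 e0 c1); exists K => t /HK; rewrite ler_pdivlMr //.
  have : 0 <= t.+1%:R^-1 :> R by rewrite invr_ge0.
  move: (t.+1%:R^-1) => s; lra.
(* In the limit <Zb, u - ph> <= 0 on [C], which [C_ri] upgrades to equality. *)
have LZb : lineality Zb.
  split; last first.
    apply: C_ri => u Cu; apply: (clusters_le ZZb) => e /(lim0 b)[K HK].
    exists K => t /HK; rewrite add0r; apply: le_trans.
    by case: (ZP t) => _ _ _; exact.
  apply: dotv_eq0; rewrite dotv_trmx.
  set w := A^T *m Zb.
  apply: (clusters_eq ZZb) => e e0.
  have w1 : 0 < dotv w w + 1 by rewrite ltr_wpDl // dotv_ge0.
  have [K HK] := lim0 a _ (divr_gt0 e0 w1); exists K => t /HK.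
  rewrite ler_pdivlMr // subr0 -dotv_trmx => h.
  apply: (le_trans (dotv_CS _ _)); case: (ZP t) => _ _ h2 _.
  have h3 := ler_wpM2r (dotv_ge0 w) h2.
  move: (dotv_ge0 w) (dotv_ge0 (A^T *m Z t)) h3 h h2.
  by move: (`|a| * _) => m *; lra.
have Zb0 : Zb = 0.
  apply: dotv_eq0; apply: (clusters_eq ZZb) => e e0; exists 0%N => t _.
  by case: (ZP t) => _ /(_ _ LZb) -> _ _; rewrite subr0 expr0n ltW.
have [t [_]] := ZZb _ ltr01 0%N; rewrite Zb0 subr0.
by case: (ZP t) => ->; rewrite ltxx.
Qed.

(** Recentring at [ph] through <Y, ph> = <A^T Y, xh>: the choice [u = ph] leaves a quadratic in A^T
    Y alone. *)
Lemma dual_minorantE Y u : dual_minorant Y u =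
  2^-1 * dotv (A^T *m Y) (A^T *m Y) - dotv (A^T *m Y) (v - xh) + dotv Y (u - ph).
Proof.
rewrite /dual_minorant /dual_quad [dotv Y (u - ph)]dotvBr -[dotv Y ph]dotv_trmx.
by rewrite !dotvW (dotvC v (A^T *m Y)); field.
Qed.

Lemma dual_minorant_lower Y :
  - (2^-1 * dotv (v - xh) (v - xh)) <= dual_minorant Y ph.
Proof.
rewrite dual_minorantE subrr dotv0; have := dotv_ge0 (A^T *m Y - (v - xh)).
by move: (A^T *m Y) (v - xh) => X w; rewrite !dotvW (dotvC w X); lra.
Qed.

Lemma level_bounded_mod_lineality (B : R) : exists c, forall Y,
  (forall l, lineality l -> dotv Y l = 0) -> dual_le Y B -> dotv Y Y <= c.
Proof.
pose w := v - xh.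
(* With X = A^T Y: |X / 2 - w|^2 >= 0 at [u = ph] yields the first bound, |X - w|^2 >= 0 at general
   [u] the second. *)
have [c Hc] := coercive_mod_lineality (4 * B + 4 * dotv w w) (B + 2^-1 * dotv w w).
exists c => Y YL YB.
apply: (Hc Y YL) => [|u Cu].
  have := YB _ C_ph; rewrite dual_minorantE -/w subrr dotv0.
  have := dotv_ge0 (2^-1 *: (A^T *m Y) - w); move: (A^T *m Y) (w) => X w'.
  rewrite !dotvW (dotvC w' X); lra.
have := YB _ Cu; rewrite dual_minorantE -/w.
have := dotv_ge0 (A^T *m Y - w); move: (A^T *m Y) (w) => X w'.
rewrite !dotvW (dotvC w' X); lra.
Qed.

(** * Dual sequences with vanishing subgradients *)

Variables (Y p : nat -> 'cV[R]_N) (B : R).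
Hypothesis C_p : forall t, C (p t).
Hypothesis Y_normal : forall t u, C u -> dotv (Y t) (u - p t) <= 0.
Hypothesis Y_bounded : forall t, dual_minorant (Y t) (p t) <= B.
Let g t := p t - A *m (v - A^T *m Y t).
Hypothesis g_to0 : forall e, 0 < e -> exists K, forall t, (K <= t)%N ->
  dotv (g t) (g t) <= e.

(** Normality puts the maximum over [C] at [p t], so this minorant value is d(Y t). *)
Lemma dual_le_iterate t : dual_le (Y t) (dual_minorant (Y t) (p t)).
Proof.
move=> u Cu; have := Y_normal t Cu; rewrite /dual_minorant dotvBr; lra.
Qed.

Lemma iterate_subgradient t Z :
  dual_minorant (Y t) (p t) + dotv (g t) (Z - Y t) <= dual_minorant Z (p t).
Proof.
have := dual_quad_gradient (Y t) Z.
have -> : dotv (g t) (Z - Y t) = dotv Z (p t) - dotv (Y t) (p t)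
    + dotv (A *m (A^T *m Y t - v)) (Z - Y t).
  by rewrite /g -[v - _]opprB mulmxN opprK dotvDl (dotvC (p t)) dotvBl.
rewrite /dual_minorant; lra.
Qed.

Lemma subgradient_orth_lineality t l : lineality l -> dotv (g t) l = 0.
Proof.
move=> [Al lu]; have := lu _ (C_p t); rewrite dotvBr -dotv_trmx Al dot0v subr0.
by rewrite /g dotvBl dotvC => ->; rewrite dotvC -dotv_trmx Al dot0v subr0.
Qed.

(** Dropping the lineality component keeps the value of d, and level sets are bounded on the
    orthogonal complement. *)
Lemma iterate_reduction : exists (Y' : nat -> 'cV[R]_N) c, forall t,
  [/\ lineality (Y t - Y' t), dual_le (Y' t) (dual_minorant (Y t) (p t)) &
      dotv (Y' t) (Y' t) <= c].
Proof.
have /choice[Y' Y'P] := fun t => lineality_decomposition (Y t).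
have [c Hc] := level_bounded_mod_lineality B.
exists Y', c => t; have [L1 L2] := Y'P t.
have le1 : dual_le (Y' t) (dual_minorant (Y t) (p t)).
  move=> u Cu; rewrite -(dual_minorant_lineality _ L1 Cu) addrC subrK.
  exact: dual_le_iterate.
split=> //; apply: Hc => // u Cu; exact: le_trans (le1 u Cu) (Y_bounded t).
Qed.

Lemma iterate_values_to_inf Z M : dual_le Z M ->
  forall e, 0 < e -> exists K, forall t, (K <= t)%N ->
    dual_minorant (Y t) (p t) <= M + e.
Proof.
move=> ZM e e0; have [Y' [c Y'P]] := iterate_reduction.
have [Z' [LZ _]] := lineality_decomposition Z.
(* This constant dominates |Y' t - Z'|^2 + 1, as [dotv_le_eps] requires. *)
have k0 : 0 < 2 * `|c| + 2 * dotv Z' Z' + 1.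
  by have := dotv_ge0 Z'; have := normr_ge0 c; lra.
have [K HK] := g_to0 (divr_gt0 (exprn_gt0 2 e0) k0); exists K => t /HK gt.
have [L1 _ b] := Y'P t.
have := iterate_subgradient t Z; have := ZM _ (C_p t).
have -> : dotv (g t) (Z - Y t) = - dotv (g t) (Y' t - Z').
  have := subgradient_orth_lineality t L1; have := subgradient_orth_lineality t LZ.
  by rewrite !dotvBr; lra.
suff : dotv (g t) (Y' t - Z') <= e by lra.
apply: dotv_le_eps => //; apply: (le_trans gt).
rewrite ler_wpM2l ?exprn_ge0 ?(ltW e0) // lef_pV2 ?posrE //.
  have := dotvDD (Y' t) (- Z'); rewrite dotvNl dotvNr opprK.
  by have := ler_norm c; lra.
by rewrite ltr_wpDl // dotv_ge0.
Qed.

(** If distances stayed large along [f], the reduced iterates would cluster at a minimizer; adding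
    back the lineality part of [Y (f t)] gives a minimizer close to [Y (f t)]. *)
Lemma iterate_dist_to0 e : 0 < e -> exists K, forall t, (K <= t)%N -> exists Z,
  (forall W M, dual_le W M -> dual_le Z M) /\ dotv (Y t - Z) (Y t - Z) <= e.
Proof.
move=> e0; apply: contrapT => /forallNP H.
have /choice[f fP] : forall K, exists t, (K <= t)%N /\ ~ exists Z,
    (forall W M, dual_le W M -> dual_le Z M) /\ dotv (Y t - Z) (Y t - Z) <= e.
  by move=> K; have /existsNP[t /not_implyP[Kt ht]] := H K; exists t.
have [Y' [c Y'P]] := iterate_reduction.
have [Zb ZZb] : exists Zb, clusters_at (Y' \o f) Zb.
  by apply: (@bounded_clusters _ _ _ c) => t /=; case: (Y'P (f t)).
have Zmin W M : dual_le W M -> dual_le Zb M.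
  move=> WM u Cu.
  (* [w] is the gradient at [Zb] of the minorant for [u]; convexity replaces the minorant by its
     linearization, and [clusters_le] passes to the limit. *)
  set w := A *m (A^T *m Zb - v) + u.
  suff : dotv Zb w <= M + dotv Zb w - dual_minorant Zb u by lra.
  apply: (clusters_le ZZb) => d /(iterate_values_to_inf WM)[K HK].
  exists K => t Kt /=.
  have {}HK := HK _ (leq_trans Kt (fP t).1).
  have [_ /(_ _ Cu) h _] := Y'P (f t).
  have := dual_quad_gradient Zb (Y' (f t)).
  move: h; rewrite /dual_minorant /w !dotvDr dotvNr.
  rewrite [dotv (A *m _) Zb]dotvC [dotv (A *m _) (Y' _)]dotvC.
  by rewrite /dual_minorant in HK *; lra.
have [t [_ /= ht]] := ZZb _ e0 0%N.
have [_ []] := fP t; have [[AL uL] _ _] := Y'P (f t).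
exists (Zb + (Y (f t) - Y' (f t))); split; last first.
  suff -> : Y (f t) - (Zb + (Y (f t) - Y' (f t))) = Y' (f t) - Zb by exact: ltW.
  by apply/matrixP => i j; rewrite !mxE; ring.
by move=> W M WM u Cu; rewrite dual_minorant_lineality //; exact: (Zmin W).
Qed.

End Dual.

(** * Proximal steps and block vectors *)

Section ProximalStep.
Variables (R : realType) (k n : nat) (C : set 'cV[R]_k) (A : 'M[R]_(k, n)) (g : R).
Hypotheses (Ccl : closed C) (Ccv : convex_setv C) (C0 : C !=set0) (g0 : 0 < g).
Hypothesis Ag : forall y, dotv (A^T *m y) (A^T *m y) <= g * dotv y y.
Variables (x : 'cV[R]_n) (y : 'cV[R]_k).

Let p := Defs.proj C (g *: y + A *m x).
Let y1 := y + g^-1 *: (A *m x) - g^-1 *: p.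

Lemma step_proj_in : C p.
Proof. by have [] := proj_variational (g *: y + A *m x) Ccl Ccv C0. Qed.

(** The projection residual is exactly [g *: y1], so this is the variational inequality divided by
    [g]. *)
Lemma step_normal u : C u -> dotv y1 (u - p) <= 0.
Proof.
move=> Cu; have [_ /(_ _ Cu)] := proj_variational (g *: y + A *m x) Ccl Ccv C0.
rewrite -/p; have -> : g *: y + A *m x - p = g *: y1.
  by rewrite /y1 scalerBr scalerDr !scalerA mulfV ?gt_eqF // !scale1r.
by rewrite dotvZl pmulr_rle0.
Qed.

Lemma step_diff : y1 - y = g^-1 *: (A *m x - p).
Proof. by rewrite /y1 addrC 2!addrA addNr add0r scalerBr. Qed.

Lemma step_proj : p = A *m x - g *: (y1 - y).
Proof. by rewrite step_diff scalerA mulfV ?gt_eqF // scale1r subKr. Qed.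

(** The primal update subtracts A^T times the dual increment; this preserves x = vbar - A^T Y. *)
Lemma step_primal :
  (1%:M - g^-1 *: (A^T *m A)) *m x + g^-1 *: (A^T *m p) = x - A^T *m (y1 - y).
Proof.
rewrite mulmxBl mul1mx -addrA; congr (_ + _).
by rewrite step_diff -scalemxAr -scalemxAl mulmxBr scalerBr opprB addrC mulmxA.
Qed.

(** Expanding |x1|^2, the cross term cancels against [dotv y1 p - dotv y p]; what remains is
    controlled by [Ag]. *)
Lemma step_descent (x1 := x - A^T *m (y1 - y)) :
  2^-1 * dotv x1 x1 + dotv y1 p <=
  2^-1 * dotv x x + dotv y p - 2^-1 * (g * dotv (y1 - y) (y1 - y)).
Proof.
have := Ag (y1 - y).
have : dotv y1 p - dotv y p = dotv (A^T *m (y1 - y)) x - g * dotv (y1 - y) (y1 - y).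
  by rewrite -dotvBl dotv_trmx -dotvZr -dotvBr -step_proj.
rewrite /x1; move: (dotv y1 p) (dotv y p) (y1 - y) (A^T *m (y1 - y)) => b c d a.
rewrite !dotvW (dotvC x a); lra.
Qed.

End ProximalStep.

Lemma sum_ord_prefixS (V : nmodType) (l : nat) (a : 'I_l -> V) (i : 'I_l) :
  \sum_(j < l | (j < i.+1)%N) a j = \sum_(j < l | (j < i)%N) a j + a i.
Proof.
rewrite (bigD1 i) //= addrC; congr (_ + _); apply: eq_bigl => j.
by rewrite ltnS ltn_neqAle andbC.
Qed.

Lemma decrease_to0 (R : realType) (F E : nat -> R) (b : R) :
  (forall t, 0 <= E t) -> (forall t, b <= F t) ->
  (forall t, F t.+1 <= F t - 2^-1 * E t) ->
  forall e, 0 < e -> exists K, forall t, (K <= t)%N -> E t <= e.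
Proof.
move=> E0 Fb FE e e0.
have hS : has_inf (range F).
  by split; [exists (F 0%N), 0%N | exists b => _ [t _ <-]].
(* Once [F] is within [e / 2] of its infimum, each later drop [2^-1 * E t] is at most [e / 2]. *)
have e2 : 0 < e / 2 by rewrite divr_gt0.
have [_ [K _ <-] FK] := inf_adherent e2 hS.
exists K => t Kt.
have : F t <= F K.
  rewrite -(subnK Kt); elim: (t - K)%N => // j; rewrite addSn.
  by have := FE (j + K)%N; have := E0 (j + K)%N; lra.
have : inf (range F) <= F t.+1 by apply: ge_inf; [exact: hS.2 | exists t.+1].
by have := FE t; lra.
Qed.

(** * Stacking the blocks into a single dual problem *)

Section Blocks.
Variables (R : realType) (l n : nat) (m : 'I_l -> nat).
Unset Implicit Arguments.
Variables (C : forall i : 'I_l, set 'cV[R]_(m i)).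
Variables (A : forall i : 'I_l, 'M[R]_(m i, n)) (vbar xh : 'cV[R]_n).
Set Implicit Arguments.
Hypothesis Cne : forall i, C i !=set0.

Definition blocks (y : blockv R l m) : 'cV[R]_(\sum_i m i) := \mxcol_i y i.
Definition prod_set : set 'cV[R]_(\sum_i m i) := [set U | forall i, C i (submxcol U i)].
Definition stackA : 'M[R]_(\sum_i m i, n) := \mxcol_i A i.

Lemma blocksK U : blocks (fun i => submxcol U i) = U.
Proof. exact: submxcolK. Qed.

Lemma prod_set_blocks u : prod_set (blocks u) <-> forall i, C i (u i).
Proof. by split=> H i; have := H i; rewrite mxcolK. Qed.

Lemma stackA_tr y : stackA^T *m blocks y = \sum_i (A i)^T *m y i.
Proof. by rewrite tr_mxcol mul_mxrow_mxcol. Qed.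

Lemma stackA_mul x : stackA *m x = blocks (fun i => A i *m x).
Proof. exact: mxcol_mul. Qed.

Lemma dotv_blocks y z : dotv (blocks y) (blocks z) = \sum_i dotv (y i) (z i).
Proof.
rewrite dotvE tr_mxcol mul_mxrow_mxcol summxE.
by apply: eq_bigr => i _; rewrite dotvE.
Qed.

Lemma blocksB y z : blocks (fun i => y i - z i) = blocks y - blocks z.
Proof. exact: mxcolB. Qed.

(** The support function of a product is the sum of the support functions, phrased with real
    inequalities. *)
Lemma sum_supp_fun_le (y : blockv R l m) (M : R) :
  (\sum_(i < l) supp_fun (C i) (y i) <= M%:E)%E <->
  forall u : blockv R l m, (forall i, C i (u i)) -> \sum_i dotv (y i) (u i) <= M.
Proof.
split=> [H u Cu|H].
  rewrite -lee_fin -sumEFin; apply: le_trans H; apply: lee_sum => i _.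
  by apply: ereal_sup_ubound; exists (u i).
have [u0 Cu0] : exists u0 : blockv R l m, forall i, C i (u0 i).
  by exists (fun i => sval (cid (Cne i))) => i; case: cid.
(* Finiteness one block at a time: block [i] varies while the others stay at [u0]. *)
have fin i : supp_fun (C i) (y i) \is a fin_num.
  apply/fin_numPlt/andP; split.
    apply: (@lt_le_trans _ _ (dotv (y i) (u0 i))%:E); first exact: ltNyr.
    by apply: ereal_sup_ubound; exists (u0 i).
  apply: (@le_lt_trans _ _
    (M - \sum_(j < l | j != i) dotv (y j) (u0 j))%:E); last exact: ltry.
  apply: ge_ereal_sup => _ [c Cc <-]; rewrite lee_fin lerBrDr.
  apply: le_trans (H (dfwith u0 i c) _); last first.
    by move=> j; case: dfwithP.
  rewrite [leRHS](bigD1 i) //= dfwithin lerD2l; apply: ler_sum => j ji.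
  by rewrite dfwithout // eq_sym.
rewrite -(eq_bigr _ (fun i _ => fineK (fin i))) sumEFin lee_fin.
apply/ler_addgt0Pr => e e0.
have l1 : 0 < l%:R + 1 :> R by rewrite ltr_wpDl.
have d0 : 0 < e / (l%:R + 1) by rewrite divr_gt0.
(* Near-maximizers within [d] in each of the [l] blocks lose at most [e] in total. *)
set d := e / _ in d0.
have adh i : exists u, C i u /\ fine (supp_fun (C i) (y i)) <= dotv (y i) u + d.
  have [_ [u Cu <-]] := ub_ereal_sup_adherent d0 (fin i).
  rewrite -[ereal_sup _](fineK (fin i)) -EFinB lte_fin => h.
  by exists u; split=> //; rewrite -lerBlDr ltW.
pose u i := sval (cid (adh i)).
have uP i : C i (u i) /\ fine (supp_fun (C i) (y i)) <= dotv (y i) (u i) + d.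
  by rewrite /u; case: cid.
apply: (@le_trans _ _ (\sum_(i < l) (dotv (y i) (u i) + d))).
  by apply: ler_sum => i _; have [] := uP i.
rewrite big_split /= lerD ?H // => [i|]; first by have [] := uP i.
rewrite sumr_const card_ord -mulr_natr /d -mulrA ger_pMr // mulrC.
by rewrite ler_pdivrMr // mul1r lerDl.
Qed.

Lemma dual_obj_le (y : blockv R l m) (M : R) :
  (dual_obj C A vbar y <= M%:E)%E <-> dual_le prod_set stackA vbar (blocks y) M.
Proof.
rewrite /dual_obj addeC -leeBrDr // -EFinB; split.
  move=> /sum_supp_fun_le H U CU; rewrite /dual_minorant /dual_quad stackA_tr.
  rewrite -(blocksK U) dotv_blocks -lerBrDl; exact: H.
move=> H; apply/sum_supp_fun_le => u /prod_set_blocks/H.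
by rewrite /dual_minorant /dual_quad stackA_tr dotv_blocks -lerBrDl.
Qed.

(** The point beyond [p] is the affine combination [(1 + d) *: p - d *: u], which relative
    interiority keeps in [D] for small [d]. *)
Lemma ri_extend (k : nat) (D : set 'cV[R]_k) p u : ri D p -> D u ->
  exists2 e : R, 0 < e & forall d, 0 < d -> d <= e -> D (p - d *: (u - p)).
Proof.
move=> [Dp [e [e0 He]]] Du; have D0 := dotv_ge0 (u - p).
have D1 : 0 < dotv (u - p) (u - p) + 1 by lra.
exists (Num.min 1 (e ^+ 2 / (dotv (u - p) (u - p) + 1))).
  by rewrite lt_min ltr01 divr_gt0 // exprn_gt0.
move=> d d0; rewrite le_min ler_pdivlMr // => /andP[d1 de]; apply: He.
  exists 2%N, (fun j => if j == ord0 then p else u).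
  exists (fun j => if j == ord0 then 1 + d else - d); split.
    by move=> j; case: ifP.
  rewrite !big_ord_recl !big_ord0 /= !addr0; split; first by ring.
  by apply/matrixP => i j; rewrite !mxE; ring.
rewrite /enorm -[ltRHS]gtr0_norm // -sqrtr_sqr ltr_sqrt ?exprn_gt0 //.
rewrite addrAC subrr add0r !dotvNl !dotvNr opprK dotvZl dotvZr.
nra.
Qed.

Hypothesis xh_ri : forall i, ri (C i) (A i *m xh).

(** Supplies [C_ri]: a common small extension past A xh in all blocks stays in the product, so the
    functional is also nonnegative at [u]. *)
Lemma prod_set_ri U : (forall u, prod_set u -> dotv U (u - stackA *m xh) <= 0) ->
  forall u, prod_set u -> dotv U (u - stackA *m xh) = 0.
Proof.
move=> H u Cu; apply/eqP; rewrite eq_le H //=.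
pose p i := A i *m xh.
have /choice[e He] : forall i, exists e, 0 < e /\ forall d, 0 < d -> d <= e ->
    C i (p i - d *: (submxcol u i - p i)).
  by move=> i; have [e e0 He] := ri_extend (xh_ri i) (Cu i); exists e.
pose d := \big[Order.min/(1 : R)]_i e i.
have d0 : 0 < d by apply: lt_bigmin => // i _; have [] := He i.
have : prod_set (stackA *m xh - d *: (u - stackA *m xh)).
  move=> i; rewrite stackA_mul submxcolB mxcolK.
  have -> W : submxcol (d *: W) i = d *: submxcol W i.
    by apply/matrixP => a b; rewrite !mxE.
  rewrite submxcolB mxcolK.
  by have [_] := He i; apply=> //; exact: bigmin_le.
move=> /H; rewrite addrAC subrr add0r dotvNr dotvZr.
by rewrite oppr_le0 pmulr_rge0.
Qed.

End Blocks.

(** * Convergence of the algorithm *)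

Lemma ord_prefix_ind (l : nat) (P : nat -> Prop) : P 0%N ->
  (forall i : 'I_l, P i -> P i.+1) -> forall k, (k <= l)%N -> P k.
Proof.
move=> P0 PS; elim=> // k IH kl; exact: (PS (Ordinal kl)) (IH (ltnW kl)).
Qed.

Section Algorithm.
Variables (R : realType) (l n : nat) (m : 'I_l -> nat).
Unset Implicit Arguments.
Variables (C : forall i : 'I_l, set 'cV[R]_(m i)).
Variables (A : forall i : 'I_l, 'M[R]_(m i, n)) (vbar xh : 'cV[R]_n).
Variable gamma : 'I_l -> R.
Set Implicit Arguments.
Hypotheses (Ccl : forall i, closed (C i)) (Ccv : forall i, convex_setv (C i)).
Hypothesis Cne : forall i, C i !=set0.
Hypothesis gamma0 : forall i, 0 < gamma i.
Hypothesis A_gamma : forall i y,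
  dotv ((A i)^T *m y) ((A i)^T *m y) <= gamma i * dotv y y.
Hypothesis xh_ri : forall i, ri (C i) (A i *m xh).

Section Sweep.
Variables (x0 : 'cV[R]_n) (Y : blockv R l m).

Let X k := inner_x C A gamma k x0 Y.
Definition sweep_proj : blockv R l m :=
  fun i => Defs.proj (C i) (gamma i *: Y i + A i *m X i).
Let Y1 i := ystep C A gamma i (X i) (Y i).
Let D i := Y1 i - Y i.
Definition sweep_energy : R := \sum_i gamma i * dotv (D i) (D i).

Lemma sweep_energy_ge0 : 0 <= sweep_energy.
Proof. by apply: sumr_ge0 => i _; rewrite mulr_ge0 ?dotv_ge0 ?ltW. Qed.

Lemma sweep_energy_ge i : gamma i * dotv (D i) (D i) <= sweep_energy.
Proof.
rewrite /sweep_energy (bigD1 i) //= lerDl.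
by apply: sumr_ge0 => j _; rewrite mulr_ge0 ?dotv_ge0 ?ltW.
Qed.

Lemma inner_xS (i : 'I_l) : X i.+1 = X i - (A i)^T *m D i.
Proof. by rewrite /X /= valK /xstep step_primal. Qed.

Lemma sweep_primal : X l = x0 - \sum_i (A i)^T *m D i.
Proof.
suff H : forall k, (k <= l)%N -> X k = x0 - \sum_(j < l | (j < k)%N) (A j)^T *m D j.
  by rewrite H //; congr (_ - _); apply: eq_bigl => j; rewrite ltn_ord.
apply: ord_prefix_ind => [|i IH].
  by rewrite big_pred0 ?subr0.
by rewrite inner_xS sum_ord_prefixS IH opprD addrA.
Qed.

(** Telescopes [step_descent] over the blocks; both sides use the same projections, so no support
    function appears yet. *)
Lemma sweep_descent :
  2^-1 * dotv (X l) (X l) + \sum_i dotv (Y1 i) (sweep_proj i) <=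
  2^-1 * dotv x0 x0 + \sum_i dotv (Y i) (sweep_proj i) - 2^-1 * sweep_energy.
Proof.
pose a i := dotv (Y1 i) (sweep_proj i) - dotv (Y i) (sweep_proj i)
  + 2^-1 * (gamma i * dotv (D i) (D i)).
suff : forall k, (k <= l)%N ->
    2^-1 * dotv (X k) (X k) + \sum_(j < l | (j < k)%N) a j <= 2^-1 * dotv x0 x0.
  move=> /(_ l (leqnn l)); rewrite (eq_bigl xpredT); last by move=> j; rewrite ltn_ord.
  by rewrite /a big_split sumrB -mulr_sumr /= -/sweep_energy; lra.
apply: ord_prefix_ind => [|i IH]; first by rewrite big_pred0 ?addr0.
rewrite sum_ord_prefixS inner_xS.
have := step_descent (C i) (gamma0 i) (@A_gamma i) (X i) (Y i).
rewrite -/(sweep_proj i) -/(Y1 i) -/(D i) /a; lra.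
Qed.

(** Block [i] was projected from [X i], not from the final [X l]; the first term is the error of
    this delay. *)
Lemma sweep_residualE i :
  sweep_proj i - A i *m X l = A i *m (X i - X l) - gamma i *: D i.
Proof.
have := step_proj (C i) (A i) (gamma0 i) (X i) (Y i).
rewrite -/(sweep_proj i) -/(Y1 i) -/(D i) => ->.
by rewrite mulmxBr addrAC.
Qed.

End Sweep.

(** Each block adds an increment of squared norm at most the energy, and |a + b|^2 <= 2 |a|^2 + 2
    |b|^2. [K] is uniform in [x0] and [Y]. *)
Lemma sweep_displacement k : (k <= l)%N -> exists2 K, 0 <= K & forall x0 Y,
  let z := inner_x C A gamma k x0 Y - x0 in dotv z z <= K * sweep_energy x0 Y.
Proof.
move: k; apply: ord_prefix_ind => [|i [K K0 HK]].
  by exists 0 => // x0 Y /=; rewrite subrr dot0v mul0r.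
exists (2 * K + 2); first lra.
move=> x0 Y; cbv zeta; rewrite inner_xS addrAC; apply: (le_trans (dotvDD _ _)).
have := HK x0 Y; rewrite /= dotvNl dotvNr opprK.
have := sweep_energy_ge x0 Y i.
move: (ystep _ _ _ _ _ _ - _) => d.
have := @A_gamma i d; lra.
Qed.

Lemma sweep_residual i : exists2 K, 0 <= K & forall x0 Y,
  let r := sweep_proj x0 Y i - A i *m inner_x C A gamma l x0 Y in
  dotv r r <= K * sweep_energy x0 Y.
Proof.
have [K1 K10 HK1] := sweep_displacement (ltnW (ltn_ord i)).
have [K2 K20 HK2] := sweep_displacement (leqnn l).
have [K3 K30 HK3] := mulmx_dotv_bound (A i).
exists (2 * (K3 * (2 * K1 + 2 * K2)) + 2 * gamma i).
  by rewrite addr_ge0 ?mulr_ge0 ?addr_ge0 ?mulr_ge0 // ltW.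
move=> x0 Y; cbv zeta; rewrite sweep_residualE; apply: (le_trans (dotvDD _ _)).
rewrite dotvNl dotvNr opprK dotvZl dotvZr [leRHS]mulrDl; apply: lerD.
  rewrite -[2 * _ * _]mulrA ler_pM2l //; apply: (le_trans (HK3 _)).
  rewrite -[K3 * _ * _]mulrA; apply: (ler_wpM2l K30).
  have := HK1 x0 Y; have := HK2 x0 Y; rewrite /=.
  set a := inner_x _ _ _ _ _ _; set b := inner_x _ _ _ _ _ _.
  have := dotvDD (b - x0) (- (a - x0)); rewrite dotvNl dotvNr opprK.
  have -> : b - x0 - (a - x0) = b - a by rewrite opprB addrA subrK.
  by move=> *; lra.
rewrite -mulrA ler_pM2l // ler_wpM2l ?(ltW (gamma0 i)) //.
exact: sweep_energy_ge.
Qed.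

Let iter t := alg C A vbar gamma t.
Let Y t : blockv R l m := (iter t).2.

(** The points at which the blocks of [Y t] are normal: the projections of the sweep that produced
    [Y t]. At time 0 the dual vector is 0, normal at the feasible points [A i *m xh]. *)
Definition iter_proj t : blockv R l m :=
  if t is s.+1 then sweep_proj (iter s).1 (Y s) else fun i => A i *m xh.

Lemma iter_primal t : (iter t).1 = vbar - \sum_i (A i)^T *m Y t i.
Proof.
elim: t => [|t IH].
  by rewrite /iter /Y /= big1 ?subr0 // => i _; rewrite mulmx0.
rewrite /iter /= -/(iter t) -/(Y t) sweep_primal IH -addrA -opprD -big_split /=.
congr (_ - _); apply: eq_bigr => i _; rewrite -mulmxDr /Y /= -/(iter t) -/(Y t).
by rewrite IH addrC subrK.
Qed.

Lemma prod_set_xh : prod_set C (stackA A *m xh).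
Proof. by rewrite stackA_mul; apply/prod_set_blocks => i; case: (xh_ri i). Qed.

Lemma iter_proj_in t : prod_set C (blocks (iter_proj t)).
Proof.
apply/prod_set_blocks => i; case: t => [|t] /=; first by case: (xh_ri i).
exact: step_proj_in.
Qed.

Lemma iter_normal t u : prod_set C u ->
  dotv (blocks (Y t)) (u - blocks (iter_proj t)) <= 0.
Proof.
move=> Cu; rewrite -(blocksK u) -blocksB dotv_blocks; apply: sumr_le0 => i _.
case: t => [|t]; first by rewrite /Y /= dot0v.
exact: step_normal.
Qed.

Let F t := dual_minorant (stackA A) vbar (blocks (Y t)) (blocks (iter_proj t)).

Lemma iter_minorantE t u : dual_minorant (stackA A) vbar (blocks (Y t)) (blocks u) =
  2^-1 * dotv (iter t).1 (iter t).1 - 2^-1 * dotv vbar vbar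
  + \sum_i dotv (Y t i) (u i).
Proof.
rewrite /dual_minorant /dual_quad stackA_tr dotv_blocks iter_primal.
by rewrite -(opprB vbar) dotvNl dotvNr opprK.
Qed.

(** [sweep_descent] compares both iterates at [iter_proj t.+1]; [dual_le_iterate] bounds the old
    minorant there by [F t]. *)
Lemma iter_descent t : F t.+1 <= F t - 2^-1 * sweep_energy (iter t).1 (Y t).
Proof.
have := dual_le_iterate (stackA A) vbar (@iter_normal) t (iter_proj_in t.+1).
rewrite -/(F t) iter_minorantE [F t.+1]iter_minorantE.
have : 2^-1 * dotv (iter t.+1).1 (iter t.+1).1
    + \sum_i dotv (Y t.+1 i) (iter_proj t.+1 i)
    <= 2^-1 * dotv (iter t).1 (iter t).1 + \sum_i dotv (Y t i) (iter_proj t.+1 i)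
       - 2^-1 * sweep_energy (iter t).1 (Y t) := sweep_descent _ _.
lra.
Qed.

Lemma iter_residual_to0 e : 0 < e -> exists K, forall t, (K <= t)%N ->
  let g := blocks (iter_proj t)
           - stackA A *m (vbar - (stackA A)^T *m blocks (Y t)) in
  dotv g g <= e.
Proof.
move=> e0; have /choice[c Hc] : forall i, exists K, 0 <= K /\ forall x0 Y,
    let r := sweep_proj x0 Y i - A i *m inner_x C A gamma l x0 Y in
    dotv r r <= K * sweep_energy x0 Y.
  by move=> i; have [K K0 HK] := sweep_residual i; exists K.
have c0 : 0 < \sum_i c i + 1.
  by rewrite ltr_wpDl // sumr_ge0 // => i _; case: (Hc i).
have Flow t : - (2^-1 * dotv (vbar - xh) (vbar - xh)) <= F t.
  apply: (le_trans (dual_minorant_lower (stackA A) _ _ (blocks (Y t)))).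
  exact: (dual_le_iterate (stackA A) vbar (@iter_normal)) prod_set_xh.
have [K HK] := decrease_to0 (fun t => sweep_energy_ge0 (iter t).1 (Y t)) Flow
  iter_descent (divr_gt0 e0 c0).
(* Shift by one: the residual at [t.+1] is controlled by the energy of sweep [t]. *)
exists K.+1 => -[//|t] /HK; rewrite ler_pdivlMr // => h; cbv zeta.
rewrite stackA_tr -iter_primal stackA_mul -blocksB dotv_blocks.
apply: le_trans h; rewrite [leRHS]mulrC mulrDl mul1r mulr_suml.
apply: (@le_trans _ _ (\sum_i c i * sweep_energy (iter t).1 (Y t))).
  by apply: ler_sum => i _; case: (Hc i) => _; exact.
by rewrite lerDl sweep_energy_ge0.
Qed.

Lemma iter_values_le_start t : F t <= F 0%N.
Proof.
elim: t => // t; apply: le_trans; apply: (le_trans (iter_descent t)).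
by rewrite gerBl mulr_ge0 ?sweep_energy_ge0.
Qed.

Lemma dual_minorant_le_obj y u : prod_set C u ->
  ((dual_minorant (stackA A) vbar (blocks y) u)%:E <= dual_obj C A vbar y)%E.
Proof.
move=> Cu; case E : dual_obj => [r||]; last 2 first.
- exact: leey.
(* An objective equal to [-oo] would lie below the minorant minus one. *)
- have : (dual_obj C A vbar y <=
      (dual_minorant (stackA A) vbar (blocks y) u - 1)%R%:E)%E by rewrite E leNye.
  by move=> /(dual_obj_le _ _ Cne _ _)/(_ _ Cu); rewrite lerBrDr gerDl ler10.
have : (dual_obj C A vbar y <= r%:E)%E by rewrite E.
by move=> /(dual_obj_le _ _ Cne _ _)/(_ _ Cu); rewrite lee_fin.
Qed.

(** By normality, [iter_proj t] attains the supremum defining the objective. *)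
Lemma dual_obj_iter t : dual_obj C A vbar (Y t) = (F t)%:E.
Proof.
apply/eqP; rewrite eq_le dual_minorant_le_obj ?andbT; last exact: iter_proj_in.
apply/dual_obj_le => //; exact: (dual_le_iterate (stackA A) vbar (@iter_normal)).
Qed.

Lemma Argmin_dualP z : (forall W M, dual_le (prod_set C) (stackA A) vbar W M ->
    dual_le (prod_set C) (stackA A) vbar (blocks z) M) -> Argmin_dual C A vbar z.
Proof.
move=> zmin w; case E : (dual_obj C A vbar w) => [r||]; last 2 first.
- exact: leey.
- by have := dual_minorant_le_obj w prod_set_xh; rewrite E leeNy_eq.
by apply/dual_obj_le => //; apply: (zmin (blocks w)); apply/dual_obj_le; rewrite ?E.
Qed.

Lemma bnorm_le (y : blockv R l m) e : 0 <= e ->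
  dotv (blocks y) (blocks y) <= e ^+ 2 -> bnorm R l m y <= e.
Proof.
move=> e0; rewrite dotv_blocks /bnorm => h.
by rewrite -[e]ger0_norm // -sqrtr_sqr ler_wsqrtr.
Qed.

Lemma iter_near_Argmin e : 0 < e -> exists K, forall t, (K <= t)%N ->
  exists z, Argmin_dual C A vbar z /\ bnorm R l m (bsub R l m (Y t) z) <= e.
Proof.
move=> e0; have [] := @iterate_dist_to0 R _ n (prod_set C) (stackA A) vbar xh
  prod_set_xh (@prod_set_ri _ _ _ _ _ _ _ xh_ri) (fun t => blocks (Y t))
  (fun t => blocks (iter_proj t)) (F 0%N) iter_proj_in iter_normal
  iter_values_le_start iter_residual_to0 (e ^+ 2).
  by rewrite exprn_gt0.
move=> K HK; exists K => t /HK[Z [Zmin Zt]].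
exists (fun i => submxcol Z i); split.
  by apply: Argmin_dualP; rewrite blocksK.
by apply: bnorm_le; [exact: ltW|rewrite blocksB blocksK].
Qed.

Lemma iter_values_eventually w e : 0 < e -> exists K, forall t, (K <= t)%N ->
  (dual_obj C A vbar (Y t) <= dual_obj C A vbar w + e%:E)%E.
Proof.
move=> e0; case E : (dual_obj C A vbar w) => [r||]; last 2 first.
- by exists 0%N => t _; rewrite addye // leey.
- by have := dual_minorant_le_obj w prod_set_xh; rewrite E leeNy_eq.
have [||K HK] := @iterate_values_to_inf R _ n (prod_set C) (stackA A) vbar xh
  prod_set_xh (@prod_set_ri _ _ _ _ _ _ _ xh_ri) (fun t => blocks (Y t))
  (fun t => blocks (iter_proj t)) (F 0%N) iter_proj_in iter_normal
  iter_values_le_start iter_residual_to0 (blocks w) r _ e.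
- by apply/dual_obj_le; rewrite ?E.
- by [].
by exists K => t /HK; rewrite dual_obj_iter -EFinD lee_fin.
Qed.

End Algorithm.

Lemma ereal_cvg_from_above (R : realType) (f : nat -> \bar R) (r : R) :
  (forall t, (r%:E <= f t)%E) ->
  (forall e, 0 < e -> exists K, forall t, (K <= t)%N -> (f t <= (r + e)%:E)%E) ->
  f @ \oo --> r%:E.
Proof.
move=> fr fe.
have fin t M : (f t <= M%:E)%E -> f t \is a fin_num.
  move=> h; apply/fin_numPlt/andP; split; first exact: lt_le_trans (ltNyr _) (fr t).
  exact: le_lt_trans h (ltry _).
apply/fine_cvgP; split.
  by have [K HK] := fe 1 ltr01; exists K => // t /HK; exact: fin.
apply/cvgrPdist_le => e e0; have [K HK] := fe _ e0; exists K => // t /HK h /=.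
have := fr t; have := fin _ _ h; move: h; case: (f t) => [s||] //.
by rewrite !lee_fin /= => *; rewrite ler_norml; apply/andP; split; lra.
Qed.

Unset Implicit Arguments.

Theorem theorem3p4 (R : realType) (l n : nat) (m : 'I_l -> nat)
  (C : forall i : 'I_l, set 'cV[R]_(m i))
  (A : forall i : 'I_l, 'M[R]_(m i, n)) (vbar : 'cV[R]_n)
  (gamma : 'I_l -> R) :
  (0 < l)%N -> (0 < n)%N -> (forall i, (0 < m i)%N) ->
  (forall i, C i !=set0) ->
  (forall i, closed (C i)) ->
  (forall i, convex_setv (C i)) ->
  (forall i, A i != 0) ->
  (exists x : 'cV[R]_n, forall i, ri (C i) (A i *m x)) ->
  (forall i, is_lambda_max ((A i)^T *m A i) (gamma i)) ->
  (fun t => dual_obj C A vbar (alg C A vbar gamma t).2) @ \oo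
     --> dual_inf C A vbar /\
  (fun t => bdist (alg C A vbar gamma t).2 (Argmin_dual C A vbar)) @ \oo
     --> 0%E.
Proof.
move=> l0 n0 m0 Cne Ccl Ccv A0 [xh xh_ri] lam.
have gamma0 i : 0 < gamma i := lambda_max_gt0 n0 (A0 i) (lam i).
have A_gamma i y : dotv ((A i)^T *m y) ((A i)^T *m y) <= gamma i * dotv y y.
  exact: rayleigh_trmx (gamma0 i) (lambda_max_rayleigh n0 (lam i)) y.
have near := iter_near_Argmin vbar Ccl Ccv Cne gamma0 A_gamma xh_ri.
have vals := iter_values_eventually vbar Ccl Ccv Cne gamma0 A_gamma xh_ri.
(* Any tolerance yields a minimizer, so the infimum is attained. *)
have [K0 HK0] := near 1 ltr01.
have [zs [zsmin _]] := HK0 _ (leqnn K0).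
have inf_zs : dual_inf C A vbar = dual_obj C A vbar zs.
  apply/eqP; rewrite eq_le; apply/andP; split.
    by apply: ereal_inf_lbound; exists zs.
  by apply: le_ereal_inf_tmp => _ [y _ <-]; exact: zsmin.
split.
  (* Bounded below by the minorant at A xh and above by the finite value at the starting point. *)
  have fin : dual_obj C A vbar zs \is a fin_num.
    apply/fin_numPlt/andP; split.
      apply: (lt_le_trans (ltNyr _)).
      exact: dual_minorant_le_obj (prod_set_xh xh_ri).
    apply: (le_lt_trans (zsmin (alg C A vbar gamma 0).2)).
    by rewrite (dual_obj_iter vbar Ccl Ccv Cne gamma0 xh_ri 0) ltry.
  rewrite inf_zs -(fineK fin); apply: ereal_cvg_from_above => [t|e e0].
    by rewrite fineK //; exact: zsmin.
  have [K HK] := vals zs e e0; exists K => t /HK.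
  by rewrite EFinD fineK.
apply: ereal_cvg_from_above => [t|e e0].
  by apply: le_ereal_inf_tmp => _ [z _ <-]; rewrite lee_fin sqrtr_ge0.
have [K HK] := near e e0; exists K => t /HK[z [zmin zt]].
rewrite add0r; apply: ge_ereal_inf; exists (bnorm R l m (bsub R l m (alg C A vbar gamma t).2 z))%:E.
  by exists z.
by rewrite lee_fin.
Qed.
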